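(* Let $H$ be a complex Hilbert space and let $A,B$ and $T$ be operators in $H$, where $B\in B(H)$. If $T^*$ is symmetric, $B$ is self-adjoint and $A$ is normal, then \[T\subset AB \Longrightarrow \overline{T}=AB.\] In particular, if we further assume that $T$ is closed, then we obtain $T=AB$.
   Context: Operators are linear, not necessarily bounded, with domain $D(\cdot)\subset H$ a linear subspace. $B(H)$ is the set of bounded operators defined on all of $H$. $S\subset T$ means $D(S)\subset D(T)$ and $Sx=Tx$ for all $x\in D(S)$. The product $ST$ has domain $D(ST)=\{x\in D(T): Tx\in D(S)\}$ and $(ST)x=S(Tx)$. Adjoints are taken of densely defined operators only, so speaking of $T^*$ presupposes that $T$ is densely defined. A densely defined operator $S$ is symmetric if $S\subset S^*$ and self-adjoint if $S=S^*$; thus ''$T^*$ is symmetric'' means that $T^*$ is densely defined and $T^*\subset T^{**}$. $S$ is normal if it is densely defined, closed and $SS^*=S^*S$ (equality including domains). $\overline{T}$ denotes the closure of $T$. *)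

(* Defs.v *)
From HB Require Import structures.
From mathcomp Require Import all_boot all_order all_algebra.
From mathcomp Require Import complex.
From mathcomp Require Import boolp classical_sets reals topology normedtype.

Set Implicit Arguments.
Unset Strict Implicit.
Unset Printing Implicit Defensive.

Import Order.TTheory GRing.Theory Num.Theory.
Import numFieldNormedType.Exports.

Local Open Scope classical_set_scope.
Local Open Scope ring_scope.
Local Open Scope complex_scope.

(* The inner product is linear in its first argument and conjugate-linear in
   its second; completeness is that of the norm, which the inner product
   induces. *)
HB.mixin Record isHilbert (R : realType) (H : Type)
    of CompleteNormedModule R[i] H := {
  hdot : {dot H for (@Num.conj R[i])} ;
  hdot_norm : forall x : H, `|x| ^+ 2 = hdot x x
}.

#[short(type="hilbertType")]
HB.structure Definition Hilbert (R : realType) :=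
  {H of isHilbert R H & CompleteNormedModule R[i] H}.

Section Operators.
Variables (R : realType) (H : hilbertType R).

(* A partially defined map on H.  The values of [pfun_val] outside [dom] are
   irrelevant: every notion below only looks at values on the domain. *)
Record pfun := Pfun { dom : set H ; pfun_val :> H -> H }.

Definition is_operator (T : pfun) : Prop :=
  [/\ dom T 0,
      forall (a : R[i]) x y, dom T x -> dom T y -> dom T (a *: x + y) &
      forall (a : R[i]) x y, dom T x -> dom T y ->
        T (a *: x + y) = a *: T x + T y].

Definition op_sub (S T : pfun) : Prop :=
  dom S `<=` dom T /\ (forall x, dom S x -> S x = T x).

(* Equality of operators, domains included. *)
Definition op_eq (S T : pfun) : Prop := op_sub S T /\ op_sub T S.

Definition op_mul (S T : pfun) : pfun :=
  Pfun [set x | dom T x /\ dom S (T x)] (fun x => S (T x)).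

Definition densely_defined (T : pfun) : Prop := dense (dom T).

Definition op_graph (T : pfun) : set (H * H) :=
  [set p | dom T p.1 /\ p.2 = T p.1].

(* [adjoint_rel T y z] says that z is a value at y for the adjoint of T. *)
Definition adjoint_rel (T : pfun) (y z : H) : Prop :=
  forall x, dom T x -> hdot (T x) y = hdot x z.

(* Meaningful for densely defined T only: z is then determined by y. *)
Definition adjoint (T : pfun) : pfun :=
  Pfun [set y | exists z, adjoint_rel T y z]
       (fun y => get [set z | adjoint_rel T y z]).

Definition op_closed (T : pfun) : Prop := closed (op_graph T).

(* The operator whose graph is the closure of the graph of T.  Meaningful for
   closable T only, e.g. when the adjoint of T is densely defined. *)
Definition op_closure (T : pfun) : pfun :=
  Pfun [set x | exists y, closure (op_graph T) (x, y)]
       (fun x => get [set y | closure (op_graph T) (x, y)]).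

Definition everywhere_bounded (T : pfun) : Prop :=
  dom T = setT /\ exists M : R[i], forall x, `|T x| <= M * `|x|.

Definition op_symmetric (T : pfun) : Prop :=
  densely_defined T /\ op_sub T (adjoint T).

Definition op_selfadjoint (T : pfun) : Prop :=
  densely_defined T /\ op_eq T (adjoint T).

Definition op_normal (T : pfun) : Prop :=
  [/\ densely_defined T, op_closed T &
      op_eq (op_mul T (adjoint T)) (op_mul (adjoint T) T)].

End Operators.

(* Main.v *)
Require Import Defs.
From HB Require Import structures.
From mathcomp Require Import all_boot all_order all_algebra.
From mathcomp Require Import complex.
From mathcomp Require Import boolp classical_sets reals topology normedtype.
From mathcomp Require Import ring lra.

(** Write [A'] for the adjoint of [A].  From [T <= A B] one gets [B A' <= T^*],
    and since [T^*] is symmetric,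
      [B A' <= T^* <= T^** <= closure of T <= A B],
    the last inclusion because [A B] is closed.  Everything thus reduces to
    showing that [B A' <= A B] forces [A B] to lie in the closure of [B A']
    ([mul_sub_closure]).

    This is done without the spectral theorem and without Fuglede's theorem.
    For [s > 0] let [G s] be the space of the vectors [x] on which all iterates
    of [A] are defined with [|A^k x|^2 <= s^k |x|^2] ([growth]); it plays the
    role of the spectral subspace of a disc.  Normality makes the sequence
    [s^-k |A^k x|^2] convex, so that a bound [C s^k] already gives membership
    ([growthP]); hence [G s] is a closed subspace, invariant under [A] and [A'].
    Since [A^k B x = B A'^k x], it is also invariant under [B].  The orthogonal
    projection [E] onto [G s] then commutes with [A], and with [B] because [B]
    is self-adjoint.  If [x] is in the domain of [A B], then
    [B A' (E x) = A B (E x) = E (A B x)], and the conclusion follows by letting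
    [E] tend to the identity.

    That the union of the [G s] is dense ([growth_dense]) is the substitute for
    the spectral theorem.  Let [Q = (1 + A' A)^-1], obtained by projecting onto
    the graph of [A], and [J = d (1 - Q)] with [d > 1].  The vectors with a
    bounded orbit under [J] form a space on which [Q] is invertible, so they lie
    in some [G s] ([growth_defect_sub]).  A vector [x] orthogonal to them
    satisfies [|x| <= |J x|] ([perp_bounded_orbit]), as is seen by solving
    [(1 + J^2 + ... + J^(2n)) y_n = x] and letting [n] grow.  A vector orthogonal
    to all [G s] therefore satisfies [|x| <= |x - Q x|], which forces [x = 0].

    None of this uses the complex structure: it is carried out in a real Hilbert
    space, and applied to the real part of the inner product. *)

Set Implicit Arguments.
Unset Strict Implicit.
Unset Printing Implicit Defensive.

Import Order.TTheory GRing.Theory Num.Theory.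
Import numFieldNormedType.Exports.

Local Open Scope classical_set_scope.
Local Open Scope ring_scope.

(** * Real Hilbert spaces *)

(** A real Hilbert space, with completeness stated for the squared norm. *)
HB.mixin Record isRealHilbert (R : realType) (V : Type) of GRing.Lmodule R V := {
  rdot : V -> V -> R;
  rdotC : forall x y, rdot x y = rdot y x;
  rdotDl : forall x y z, rdot (x + y) z = rdot x z + rdot y z;
  rdotZl : forall a x y, rdot (a *: x) y = a * rdot x y;
  rdot_ge0 : forall x, 0 <= rdot x x;
  rdot_eq0 : forall x, rdot x x = 0 -> x = 0;
  rdot_complete : forall u : nat -> V,
    (forall e, 0 < e -> exists N, forall m n, (N <= m)%N -> (N <= n)%N ->
       rdot (u m - u n) (u m - u n) < e) ->
    exists y, forall e, 0 < e -> exists N, forall n, (N <= n)%N ->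
       rdot (u n - y) (u n - y) < e
}.

#[short(type="realHilbertType")]
HB.structure Definition RealHilbert (R : realType) :=
  {V of isRealHilbert R V & GRing.Lmodule R V}.

Lemma discriminant_le (R : realFieldType) (a b c : R) : 0 <= c ->
  (forall t, 0 <= a - 2 * t * b + t ^+ 2 * c) -> b ^+ 2 <= a * c.
Proof.
rewrite le_eqVlt => /orP[/eqP <-|c0] quad.
  rewrite mulr0; have [->|b0] := eqVneq b 0; first by rewrite expr0n.
  have := quad ((a + 1) / (2 * b)); rewrite mulr0 addr0.
  have -> : a - 2 * ((a + 1) / (2 * b)) * b = -1 by field.
  lra.
have := quad (b / c).
have -> : a - 2 * (b / c) * b + (b / c) ^+ 2 * c = (a * c - b ^+ 2) / c.
  by field; lra.
by rewrite pmulr_lge0 ?invr_gt0 // subr_ge0.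
Qed.

Section RealHilbertTheory.
Variables (R : realType) (V : realHilbertType R).
Implicit Types (x y z v w : V) (M : set V) (e s t : R).

(** The squared norm, used throughout in place of the norm to avoid roots. *)
Definition sqn x : R := rdot x x.

Lemma rdotDr x y z : rdot x (y + z) = rdot x y + rdot x z.
Proof. by rewrite rdotC rdotDl !(rdotC x). Qed.

Lemma rdotZr t x y : rdot x (t *: y) = t * rdot x y.
Proof. by rewrite rdotC rdotZl rdotC. Qed.

Lemma rdotNl x y : rdot (- x) y = - rdot x y.
Proof. by rewrite -scaleN1r rdotZl mulN1r. Qed.

Lemma rdotNr x y : rdot x (- y) = - rdot x y.
Proof. by rewrite rdotC rdotNl rdotC. Qed.

Lemma rdot0l x : rdot 0 x = 0.
Proof. by rewrite -(scale0r 0) rdotZl mul0r. Qed.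

Lemma rdot0r x : rdot x 0 = 0.
Proof. by rewrite rdotC rdot0l. Qed.

Definition rdotE := (@rdotDl R V, rdotDr, rdotNl, rdotNr, @rdotZl R V, rdotZr,
  rdot0l, rdot0r).

Lemma rdot_inj x y : (forall z, rdot x z = rdot y z) -> x = y.
Proof.
move=> h; apply/eqP; rewrite -subr_eq0; apply/eqP/rdot_eq0.
by rewrite rdotDl rdotNl h subrr.
Qed.

Lemma sqn_ge0 x : 0 <= sqn x.
Proof. exact: rdot_ge0. Qed.

Lemma sqn0 : sqn 0 = 0.
Proof. exact: rdot0l. Qed.

Lemma sqn_eq0 x : sqn x <= 0 -> x = 0.
Proof. by move=> h; apply: rdot_eq0; apply/eqP; rewrite eq_le h sqn_ge0. Qed.

Lemma sqnB x y : sqn (x - y) = sqn x - 2 * rdot x y + sqn y.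
Proof. by rewrite /sqn !rdotE (rdotC y x); ring. Qed.

Lemma sqnD x y : sqn (x + y) = sqn x + 2 * rdot x y + sqn y.
Proof. by rewrite /sqn !rdotE (rdotC y x); ring. Qed.

Lemma sqnZ t x : sqn (t *: x) = t ^+ 2 * sqn x.
Proof. by rewrite /sqn !rdotE; ring. Qed.

Lemma sqnN x : sqn (- x) = sqn x.
Proof. by rewrite /sqn !rdotE; ring. Qed.

Lemma sqnBC x y : sqn (x - y) = sqn (y - x).
Proof. by rewrite -opprB sqnN. Qed.

Lemma sqnD_le x y : sqn (x + y) <= 2 * sqn x + 2 * sqn y.
Proof. by have := sqn_ge0 (x - y); rewrite sqnB sqnD; lra. Qed.

Lemma rdot_cauchy_schwarz x y : rdot x y ^+ 2 <= sqn x * sqn y.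
Proof.
apply: discriminant_le => [|t]; first exact: sqn_ge0.
by have := sqn_ge0 (x - t *: y); rewrite sqnB sqnZ rdotZr; lra.
Qed.

Lemma sqn_triangle x y z : sqn (x - z) <= 2 * sqn (x - y) + 2 * sqn (y - z).
Proof. by have := sqnD_le (x - y) (y - z); rewrite addrA subrK. Qed.

(** A real form of Young's inequality. *)
Lemma rdot_young x y t : 0 < t -> 2 * rdot x y <= t * sqn x + sqn y / t.
Proof.
move=> t0; have := sqn_ge0 (t *: x - y); rewrite sqnB sqnZ rdotZl => h.
have := mulr_ge0 (ltW (divr_gt0 ltr01 t0)) h.
have -> : 1 / t * (t ^+ 2 * sqn x - 2 * (t * rdot x y) + sqn y) =
  t * sqn x - 2 * rdot x y + sqn y / t by field; lra.
lra.
Qed.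

Lemma sqn_continuous x e : 0 < e ->
  exists2 d, 0 < d & forall y, sqn (y - x) < d -> `|sqn y - sqn x| < e.
Proof.
move=> e0; have nx := sqn_ge0 x.
pose t := e / (2 * (sqn x + 1)).
have t0 : 0 < t by rewrite divr_gt0 //; lra.
have tx : t * (2 * (sqn x + 1)) = e by rewrite /t; field; lra.
exists (e / 2 / (1 + t^-1)) => [|y].
  by rewrite !divr_gt0 //; have := invr_gt0 t; rewrite t0; lra.
have ti : 0 < t^-1 by rewrite invr_gt0.
rewrite ltr_pdivlMr; last lra.
move=> hy; have := rdot_young x (y - x) t0; have := rdot_young x (- (y - x)) t0.
have -> : sqn y = sqn (y - x) + 2 * rdot x (y - x) + sqn x.
  by have := sqnD (y - x) x; rewrite subrK (rdotC _ x) => ->; ring.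
rewrite rdotNr sqnN => h1 h2.
have := sqn_ge0 (y - x); clearbody t.
move: hy; rewrite mulrDr mulr1 => hy n0.
by rewrite ltr_norml; apply/andP; split; lra.
Qed.

(** Closure of a set for the norm. *)
Definition adherent M x := forall e, 0 < e -> exists2 y, M y & sqn (y - x) < e.

(** Convergence of a sequence for the norm. *)
Definition cvgto (u : nat -> V) x :=
  forall e, 0 < e -> exists N, forall n, (N <= n)%N -> sqn (u n - x) < e.

Lemma sqn_complete (u : nat -> V) :
  (forall e, 0 < e -> exists N, forall m n, (N <= m)%N -> (N <= n)%N ->
     sqn (u m - u n) < e) ->
  exists y, cvgto u y.
Proof. exact: rdot_complete. Qed.

(** Linear subspaces. *)
Definition lsubspace M := M 0 /\ forall t x y, M x -> M y -> M (t *: x + y).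

Lemma lsubspaceB M x y : lsubspace M -> M x -> M y -> M (x - y).
Proof. by case=> _ h Mx My; rewrite addrC -scaleN1r; apply: h. Qed.

Lemma lsubspaceD M x y : lsubspace M -> M x -> M y -> M (x + y).
Proof. by case=> _ h Mx My; rewrite -[x]scale1r; apply: h. Qed.

Lemma lsubspaceZ M t x : lsubspace M -> M x -> M (t *: x).
Proof. by case=> M0 h Mx; rewrite -[X in M X]addr0; apply: h. Qed.

Lemma adherent_mono M M' x : M `<=` M' -> adherent M x -> adherent M' x.
Proof. by move=> MM' h e /h[y /MM' My ye]; exists y. Qed.

Lemma adherent_adherent M x : adherent (adherent M) x -> adherent M x.
Proof.
move=> h e e0; have e4 : 0 < e / 4 by lra.
have [y My yx] := h _ e4; have [z Mz zy] := My _ e4.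
by exists z => //; have := sqn_triangle z y x; lra.
Qed.

Lemma invSn_gt0 n : 0 < n.+1%:R^-1 :> R.
Proof. by rewrite invr_gt0. Qed.

Lemma invSn_small e : 0 < e -> exists N, forall n, (N <= n)%N -> n.+1%:R^-1 < e.
Proof.
move=> e0; exists (Num.truncn e^-1) => n Nn.
rewrite invf_plt ?posrE //; apply: (lt_le_trans (truncnS_gt _)).
by rewrite ler_nat ltnS.
Qed.

Lemma adherent_seq M x : adherent M x ->
  exists u : nat -> V, (forall n, M (u n)) /\ forall n, sqn (u n - x) < n.+1%:R^-1.
Proof.
move=> h; have /choice[u hu] n : exists y, M y /\ sqn (y - x) < n.+1%:R^-1.
  by have [y] := h _ (invSn_gt0 n); exists y.
by exists u; split=> n; case: (hu n).
Qed.

(** The orthogonal complement is closed. *)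
Lemma adherent_perp M p x :
  adherent M x -> (forall y, M y -> rdot y p = 0) -> rdot x p = 0.
Proof.
move=> Mx h; apply/eqP; rewrite -sqrf_eq0; apply/eqP/le_anti.
rewrite sqr_ge0 andbT; apply/ler_addgt0Pr => e e0; rewrite add0r.
have p1 : 0 < sqn p + 1 by have := sqn_ge0 p; lra.
have [y My yx] := Mx _ (divr_gt0 e0 p1).
have -> : rdot x p = rdot (x - y) p by rewrite rdotDl rdotNl (h y) // subr0.
have := rdot_cauchy_schwarz (x - y) p; rewrite sqnBC.
move: yx; rewrite ltr_pdivlMr //.
have := sqn_ge0 p; have := sqn_ge0 (y - x); nra.
Qed.

(** The orthogonal projection onto the closure of a subspace. *)
Lemma projection M x : lsubspace M ->
  exists2 y, adherent M y & forall z, M z -> rdot (x - y) z = 0.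
Proof.
move=> sM; have [M0 _] := sM.
pose S := [set sqn (x - z) | z in M].
have Sinf : has_inf S.
  by split; [exists (sqn (x - 0)), 0 | exists 0 => _ [z _ <-]; exact: sqn_ge0].
pose d := inf S.
have dle z : M z -> d <= sqn (x - z).
  by move=> Mz; apply: ge_inf; [case: Sinf | exists z].
have /choice[u hu] n : exists z, M z /\ sqn (x - z) < d + n.+1%:R^-1.
  have [_ [z Mz <-] h] := inf_adherent (invSn_gt0 n) Sinf.
  by exists z.
have Mu n : M (u n) by case: (hu n).
have du n : sqn (x - u n) < d + n.+1%:R^-1 by case: (hu n).
(* parallelogram identity, applied at the midpoint *)
have par m n : sqn (u m - u n) <= 2 * m.+1%:R^-1 + 2 * n.+1%:R^-1.
  have := dle _ (lsubspaceZ (2^-1) sM (lsubspaceD sM (Mu m) (Mu n))).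
  have -> : x - 2^-1 *: (u m + u n) = 2^-1 *: ((x - u m) + (x - u n)).
    by apply: rdot_inj => z; rewrite !rdotE; field.
  rewrite sqnZ sqnD.
  have -> : u m - u n = (x - u n) - (x - u m).
    by apply: rdot_inj => z; rewrite !rdotE; ring.
  rewrite (sqnB (x - u n) (x - u m)) (rdotC (x - u n)).
  have -> : (2^-1 : R) ^+ 2 = 4^-1 by field.
  have := du m; have := du n.
  move: m.+1%:R^-1 n.+1%:R^-1 => a b h1 h2 h3; lra.
have [|y uy] := @sqn_complete u.
  move=> e e0.
  have [N hN] : exists N, forall n, (N <= n)%N -> n.+1%:R^-1 < e / 4.
    by apply: invSn_small; lra.
  exists N => m n /hN hm /hN hn; apply: le_lt_trans (par m n) _.
  by move: m.+1%:R^-1 n.+1%:R^-1 hm hn => a b; lra.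
exists y => [e e0|z Mz].
  by have [N hN] := uy _ e0; exists (u N) => //; apply: hN.
(* the error at stage n is almost orthogonal to z, by minimality *)
have small n : rdot (x - u n) z ^+ 2 <= n.+1%:R^-1 * sqn z.
  apply: discriminant_le => [|t]; first exact: sqn_ge0.
  have := dle _ (lsubspaceD sM (Mu n) (lsubspaceZ t sM Mz)).
  rewrite opprD addrA sqnB rdotZr sqnZ; have := du n.
  by move: n.+1%:R^-1 => a; lra.
apply/eqP; rewrite -sqrf_eq0; apply/eqP/le_anti; rewrite sqr_ge0 andbT.
apply/ler_addgt0Pr => e e0; rewrite add0r.
have nz := sqn_ge0 z; have z1 : 0 < sqn z + 1 by lra.
have ez : 0 < e / 4 / (sqn z + 1) by rewrite !divr_gt0.
have [N1 h1] := uy _ ez; have [N2 h2] := invSn_small ez.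
pose n := maxn N1 N2.
have {h1} := h1 n (leq_maxl _ _); have {h2} := h2 n (leq_maxr _ _).
rewrite !ltr_pdivlMr // => h2 h1.
have := small n; set b := rdot _ _ => sb.
have -> : rdot (x - y) z = rdot (u n - y) z + b by rewrite /b !rdotE; ring.
set c := rdot _ _.
have : c ^+ 2 <= sqn (u n - y) * (sqn z + 1).
  have := rdot_cauchy_schwarz (u n - y) z; have := sqn_ge0 (u n - y).
  by rewrite -/c; nra.
move: h2 sb (@invSn_gt0 n); move: n.+1%:R^-1 => a h2 sb a0 hc.
have := sqr_ge0 (b - c); nra.
Qed.

End RealHilbertTheory.

(** * Products, and continuity of linear relations *)

Section Product.
Variables (R : realType) (V W : realHilbertType R).
Implicit Types p q r : (V * W)%type.

(** The inner product of the orthogonal direct sum. *)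
Definition pair_rdot p q : R := rdot p.1 q.1 + rdot p.2 q.2.

Lemma pair_rdotC p q : pair_rdot p q = pair_rdot q p.
Proof. by rewrite /pair_rdot rdotC (rdotC p.2). Qed.

Lemma pair_rdotDl p q r :
  pair_rdot (p + q) r = pair_rdot p r + pair_rdot q r.
Proof. by rewrite /pair_rdot /= !rdotDl; ring. Qed.

Lemma pair_rdotZl (a : R) p q : pair_rdot (a *: p) q = a * pair_rdot p q.
Proof. by rewrite /pair_rdot /= !rdotZl; ring. Qed.

Lemma pair_rdot_ge0 p : 0 <= pair_rdot p p.
Proof. by rewrite addr_ge0 ?rdot_ge0. Qed.

Lemma pair_rdot_eq0 p : pair_rdot p p = 0 -> p = 0.
Proof.
case: p => x y /eqP; rewrite paddr_eq0 ?rdot_ge0 //= => /andP[/eqP hx /eqP hy].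
by rewrite (rdot_eq0 _ hx) (rdot_eq0 _ hy).
Qed.

Lemma pair_rdot_complete (u : nat -> V * W) :
  (forall e, 0 < e -> exists N, forall m n, (N <= m)%N -> (N <= n)%N ->
     pair_rdot (u m - u n) (u m - u n) < e) ->
  exists y, forall e, 0 < e -> exists N, forall n, (N <= n)%N ->
     pair_rdot (u n - y) (u n - y) < e.
Proof.
move=> cu.
have [|y1 h1] := @sqn_complete _ V (fun n => (u n).1).
  move=> e /cu[N hN]; exists N => m n hm hn; apply: le_lt_trans (hN m n hm hn).
  by rewrite lerDl rdot_ge0.
have [|y2 h2] := @sqn_complete _ W (fun n => (u n).2).
  move=> e /cu[N hN]; exists N => m n hm hn; apply: le_lt_trans (hN m n hm hn).
  by rewrite lerDr rdot_ge0.
exists (y1, y2) => e e0; have e2 : 0 < e / 2 by lra.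
have [N1 k1] := h1 _ e2; have [N2 k2] := h2 _ e2.
exists (maxn N1 N2) => n; rewrite geq_max => /andP[/k1 l1 /k2 l2].
by move: l1 l2; rewrite /pair_rdot /sqn /=; lra.
Qed.

HB.instance Definition _ := isRealHilbert.Build R (V * W)%type
  pair_rdotC pair_rdotDl pair_rdotZl pair_rdot_ge0 pair_rdot_eq0
  pair_rdot_complete.

Lemma rdot_pair (p q : (V * W)%type) : rdot p q = rdot p.1 q.1 + rdot p.2 q.2.
Proof. by []. Qed.

Lemma sqn_pair p : sqn p = sqn p.1 + sqn p.2.
Proof. by []. Qed.

Lemma adherent_pair (M : set (V * W)) x y :
  adherent M (x, y) <-> forall e, 0 < e ->
    exists p, [/\ M p, sqn (p.1 - x) < e & sqn (p.2 - y) < e].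
Proof.
split=> h e e0.
  have [p Mp] := h _ e0; rewrite sqn_pair /= => pe; exists p; split => //.
    by have := sqn_ge0 (p.2 - y); lra.
  by have := sqn_ge0 (p.1 - x); lra.
have e2 : 0 < e / 2 by lra.
by have [p [Mp p1 p2]] := h _ e2; exists p => //; rewrite sqn_pair /=; lra.
Qed.

(** The inequality [sqn p.2 <= s * sqn p.1] passes to the closure. *)
Lemma adherent_le (M : set (V * W)) s x y : 0 <= s ->
  (forall p, M p -> sqn p.2 <= s * sqn p.1) ->
  adherent M (x, y) -> sqn y <= s * sqn x.
Proof.
move=> s0 hM hxy; apply/ler_addgt0Pr => e e0.
have e2 : 0 < e / 2 / (s + 1) by rewrite !divr_gt0 //; lra.
have [d1 d10 h1] := sqn_continuous x e2.
have [d2 d20 h2] := sqn_continuous y e2.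
have d0 : 0 < Num.min d1 d2 by rewrite lt_min d10 d20.
move/adherent_pair: hxy => /(_ _ d0)[p [Mp]].
rewrite !lt_min => /andP[/h1 k1 _] /andP[_ /h2 k2].
have := hM _ Mp; move: k1 k2.
have : e / 2 / (s + 1) * (s + 1) = e / 2 by field; lra.
move: e2; move: (e / 2 / (s + 1)) => c c0 hc.
rewrite !ltr_norml => /andP[k1 k2] /andP[k3 k4]; nra.
Qed.

(** Extension by continuity, for a bounded linear relation. *)
Lemma bounded_extension (M : set (V * W)) s x : 0 <= s -> lsubspace M ->
  (forall p, M p -> sqn p.2 <= s * sqn p.1) ->
  adherent [set p.1 | p in M] x -> exists y, adherent M (x, y).
Proof.
move=> s0 sM hM /adherent_seq[v [Mv vx]].
have /choice[u hu] n : exists p, M p /\ p.1 = v n.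
  by have [p Mp pv] := Mv n; exists p.
have Mu n : M (u n) by case: (hu n).
have uv n : (u n).1 = v n by case: (hu n).
have [|y uy] := @sqn_complete _ W (fun n => (u n).2).
  move=> e e0; have es : 0 < e / 4 / (s + 1) by rewrite !divr_gt0 //; lra.
  have [N hN] := invSn_small es.
  exists N => m n /hN hm /hN hn.
  have := hM _ (lsubspaceB sM (Mu m) (Mu n)); rewrite /= !uv => h.
  have := sqn_triangle (v m) x (v n); rewrite (sqnBC x).
  have := vx m; have := vx n.
  have : e / 4 / (s + 1) * (s + 1) = e / 4 by field; lra.
  move: hm hn; move: (e / 4 / _) m.+1%:R^-1 n.+1%:R^-1 => c a b ac bc hc h1 h2.
  nra.
exists y; apply/adherent_pair => e e0.
have [N1 h1] := uy _ e0; have [N2 h2] := invSn_small e0.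
exists (u (maxn N1 N2)); split=> //; last exact: h1 (leq_maxl _ _).
by rewrite uv; apply: lt_trans (vx _) (h2 _ (leq_maxr _ _)).
Qed.

End Product.

(** * Partially defined linear operators *)

Section Operators.
Variables (R : realType) (V : realHilbertType R).
Implicit Types (x y z : V) (D M : set V) (A : V -> V) (e s t : R).

(** The graph of the restriction of [A] to [D]. *)
Definition graph_on D A : set (V * V) := [set p | D p.1 /\ p.2 = A p.1].

(** [A] is a linear operator with domain [D]; its values outside [D] are
    irrelevant. *)
Definition linear_on D A :=
  lsubspace D /\ forall t x y, D x -> D y -> A (t *: x + y) = t *: A x + A y.

(** [A], with domain [D], has a closed graph. *)
Definition closed_on D A :=
  forall x y, adherent (graph_on D A) (x, y) -> D x /\ y = A x.

Lemma linear_onB D A x y : linear_on D A -> D x -> D y ->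
  A (x - y) = A x - A y.
Proof.
by move=> [_ h] Dx Dy; rewrite addrC -scaleN1r h // scaleN1r addrC.
Qed.

Lemma linear_on0 D A : linear_on D A -> A 0 = 0.
Proof.
by move=> lA; rewrite -(subr0 0) (linear_onB lA) ?subrr //; case: lA => -[].
Qed.

Lemma linear_onD D A x y : linear_on D A -> D x -> D y ->
  A (x + y) = A x + A y.
Proof. by move=> [_ h] Dx Dy; rewrite -[x]scale1r h // !scale1r. Qed.

Lemma graph_subspace D A : linear_on D A -> lsubspace (graph_on D A).
Proof.
move=> lA; have [[D0 sD] h] := lA; split=> [|t [x1 x2] [y1 y2] [/= Dx ->] [/= Dy ->]].
  by split => //=; rewrite (linear_on0 lA).
by split => //=; [exact: sD | rewrite h].
Qed.

Lemma linear_on_subset D M A :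
  lsubspace M -> M `<=` D -> linear_on D A -> linear_on M A.
Proof. by move=> sM MD [_ h]; split=> // t x y /MD Dx /MD Dy; exact: h. Qed.

Lemma lsubspaceT : lsubspace [set: V].
Proof. by []. Qed.

(** ** Everywhere defined symmetric operators *)

(** An everywhere defined symmetric operator; boundedness is not part of the
    definition. *)
Definition selfadjoint (L : V -> V) :=
  linear_on setT L /\ forall x y, rdot (L x) y = rdot x (L y).

(** Symmetry on the whole space forces a closed graph. *)
Lemma selfadjoint_closed L : selfadjoint L -> closed_on setT L.
Proof.
move=> [_ sL] x y h; split=> //; apply: rdot_inj => z; rewrite sL.
have /eqP : rdot (x, y) (- L z, z) = 0.
  apply: adherent_perp h _ => -[a b] [_ /= ->].
  by rewrite rdot_pair /= rdotNr sL; ring.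
by rewrite rdot_pair /= rdotNr addrC subr_eq0 => /eqP.
Qed.

(** A symmetric operator that is bounded below on a closed invariant subspace
    maps that subspace onto itself. *)
Lemma selfadjoint_onto L M c : selfadjoint L -> 0 < c -> lsubspace M ->
  (forall x, adherent M x -> M x) -> (forall x, M x -> M (L x)) ->
  (forall x, M x -> c * sqn x <= sqn (L x)) ->
  forall x, M x -> exists2 y, M y & L y = x.
Proof.
move=> saL c0 sM cM iM lbM x Mx; have [lL sL] := saL.
have lLM := linear_on_subset sM (@subsetT _ M) lL.
pose N := [set (p.2, p.1) | p in graph_on M L].
have sN : lsubspace N.
  have [g0 gs] := graph_subspace lLM.
  split=> [|t _ _ [p gp <-] [q gq <-]]; first by exists 0.
  by exists (t *: p + q) => //; exact: gs.
have bN p : N p -> sqn p.2 <= c^-1 * sqn p.1.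
  by move=> [[a b] [/= Ma ->] <-] /=; rewrite -ler_pdivrMl ?invr_gt0 // invrK lbM.
have sfN : lsubspace [set p.1 | p in N].
  have [g0 gs] := sN; split=> [|t _ _ [p gp <-] [q gq <-]]; first by exists 0.
  by exists (t *: p + q) => //; exact: gs.
have [z az pz] := projection x sfN.
have ic0 : 0 <= c^-1 by rewrite invr_ge0 ltW.
have [y azy] := bounded_extension ic0 sN bN az.
have [_ zy] : setT y /\ z = L y.
  apply: (selfadjoint_closed saL) => e /azy[p [[a b] [/= Ma ->] <-]].
  by rewrite !sqn_pair /= => h; exists (a, L a) => //; rewrite sqn_pair /=; lra.
have My : M y.
  apply: cM => e /azy[p [[a b] [/= Ma ->] <-]].
  rewrite !sqn_pair /= => h; exists a => //.
  by have := sqn_ge0 (L a - z); lra.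
exists y => //; apply/esym/eqP; rewrite -subr_eq0 -zy; apply/eqP.
have Mw : M (x - z) by apply: lsubspaceB => //; rewrite zy; exact: iM.
(* [x - z] is orthogonal to the range, hence in the kernel *)
have : sqn (L (x - z)) = 0.
  rewrite /sqn sL rdotC -[RHS](pz (L (L (x - z)))); first by rewrite rdotC.
  by exists (L (L (x - z)), L (x - z)) => //; exists (L (x - z), L (L (x - z)));
    split=> //=; exact: iM.
by have := lbM _ Mw => + h; rewrite h pmulr_rle0 // => /sqn_eq0.
Qed.

End Operators.

(** * Vectors of geometric growth *)

Lemma bounded_convex_le (R : realType) (b : nat -> R) C :
  (forall k, 2 * b k.+1 <= b k + b k.+2) -> (forall k, b k <= C) ->
  forall k, b k <= b 0%N.
Proof.
move=> cb bC.
(* a strict increase would persist by convexity and make [b] unbounded *)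
suff dec k : b k.+1 <= b k.
  by elim=> // k IH; exact: le_trans (dec k) IH.
rewrite leNgt; apply/negP => hk.
pose d := b k.+1 - b k; have d0 : 0 < d by rewrite subr_gt0.
have grow j : d <= b (k + j).+1 - b (k + j)%N.
  elim: j => [|j IH]; first by rewrite addn0.
  by rewrite addnS; have := cb (k + j)%N; lra.
have lin j : b k + j%:R * d <= b (k + j)%N.
  elim: j => [|j IH]; first by rewrite mul0r addr0 addn0.
  by rewrite addnS -natr1 mulrDl mul1r; have := grow j; lra.
have := lin (Num.truncn ((C - b k) / d)).+1.
have := truncnS_gt ((C - b k) / d); rewrite ltr_pdivrMr // => h1 h2.
by have := bC (k + (Num.truncn ((C - b k) / d)).+1)%N; lra.
Qed.

Section Growth.
Variables (R : realType) (V : realHilbertType R).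
Variables (D : set V) (A : V -> V).
Implicit Types (x y z : V) (e s t C : R).

(** The vectors on which the iterates of [A] are defined and grow at most
    geometrically, [s] being the square of the ratio.  For a normal operator
    this is the spectral subspace of the disc of radius [sqrt s]. *)
Definition growth s : set V :=
  [set x | forall k, D (iter k A x) /\ sqn (iter k A x) <= s ^+ k * sqn x].

(** Paranormality, [|A x|^2 <= |x| |A (A x)|], in a form free of roots. *)
Definition paranormal := forall t x, 0 < t -> D x -> D (A x) ->
  2 * t * sqn (A x) <= sqn x + t ^+ 2 * sqn (A (A x)).

Lemma growth_dom s x : growth s x -> D x.
Proof. by move=> /(_ 0%N)[]. Qed.

Lemma growth_sqn s x : growth s x -> sqn (A x) <= s * sqn x.
Proof. by move=> /(_ 1%N)[]; rewrite expr1. Qed.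

Lemma growth_mono s s' x : 0 <= s -> s <= s' -> growth s x -> growth s' x.
Proof.
move=> s0 ss' h k; have [Dk hk] := h k; split=> //; apply: le_trans hk _.
by rewrite ler_wpM2r ?sqn_ge0 // lerXn2r ?nnegrE //; lra.
Qed.

Hypotheses (lA : linear_on D A) (cA : closed_on D A) (pA : paranormal).

(** For a paranormal operator the multiplicative constant in a geometric bound
    on the iterates can be taken to be one. *)
Lemma growthP s C x : 0 < s ->
  (forall k, D (iter k A x) /\ sqn (iter k A x) <= C * s ^+ k) -> growth s x.
Proof.
move=> s0 h k; split; first by case: (h k).
have sk j : 0 < s ^+ j by rewrite exprn_gt0.
have := @bounded_convex_le R (fun k => sqn (iter k A x) / s ^+ k) C _ _ k.
rewrite /= expr0 divr1 ler_pdivrMr // mulrC; apply=> j; last first.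
  by rewrite ler_pdivrMr //; case: (h j).
have t0 : 0 < s^-1 by rewrite invr_gt0.
have [[Dj _] [/= Dj1 _]] := (h j, h j.+1).
have := pA t0 Dj Dj1; rewrite -(ler_pM2l (_ : 0 < (s ^+ j)^-1)); last first.
  by rewrite invr_gt0.
set a := sqn _; set b := sqn (iter j A x); set c := sqn _.
have -> : a / s ^+ j.+1 = a / s ^+ j / s by rewrite exprS; field; rewrite ?lt0r_neq0.
have -> : c / s ^+ j.+2 = c / s ^+ j / s / s.
  by rewrite !exprS; field; rewrite ?lt0r_neq0.
have -> : (s ^+ j)^-1 * (2 * s^-1 * a) = 2 * (a / s ^+ j / s).
  by field; rewrite ?lt0r_neq0.
suff -> : (s ^+ j)^-1 * (b + s^-1 ^+ 2 * c) = b / s ^+ j + c / s ^+ j / s / s.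
  by [].
by field; rewrite ?lt0r_neq0.
Qed.

Lemma iter_linear k t x y :
  (forall j, D (iter j A x)) -> (forall j, D (iter j A y)) ->
  D (iter k A (t *: x + y)) /\
  iter k A (t *: x + y) = t *: iter k A x + iter k A y.
Proof.
move=> Dx Dy; have [[D0 sD] h] := lA.
by elim: k => [|k [_ /= ->]]; rewrite /= ?h //; split => //; apply: sD => //;
   [exact: (Dx 0%N) | exact: (Dy 0%N) | exact: (Dx k.+1) | exact: (Dy k.+1)].
Qed.

Lemma growth_subspace s : 0 < s -> lsubspace (growth s).
Proof.
move=> s0; have [[D0 _] _] := lA; split=> [k|t x y gx gy].
  have -> : iter k A 0 = 0 by elim: k => //= k ->; rewrite (linear_on0 lA).
  by rewrite sqn0 mulr0.
apply: (@growthP s (2 * t ^+ 2 * sqn x + 2 * sqn y)) => // k.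
have [Dk ->] := iter_linear k t (fun j => (gx j).1) (fun j => (gy j).1).
split; first by have [[_ sD] _] := lA; apply: sD; [case: (gx k) | case: (gy k)].
apply: le_trans (sqnD_le _ _) _; rewrite sqnZ.
have [_ h1] := gx k; have [_ h2] := gy k.
have := sqr_ge0 t; have := sqn_ge0 (iter k A x); nra.
Qed.

Lemma growth_stable s x : 0 < s -> growth s x -> growth s (A x).
Proof.
move=> s0 gx; apply: (@growthP s (s * sqn x)) => // k.
by rewrite -iterSr; have [Dk hk] := gx k.+1; split=> //; move: hk; rewrite exprS; lra.
Qed.

Lemma growth_closed s x : 0 < s -> adherent (growth s) x -> growth s x.
Proof.
move=> s0; have sG := growth_subspace s0.
have GD : growth s `<=` D by move=> y; exact: growth_dom.
have lG := linear_on_subset sG GD lA.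
have step y : adherent (growth s) y ->
    [/\ D y, adherent (growth s) (A y) & sqn (A y) <= s * sqn y].
  move=> ay.
  have bG p : graph_on (growth s) A p -> sqn p.2 <= s * sqn p.1.
    by move=> [gp ->]; exact: growth_sqn.
  have [|z az] := @bounded_extension _ _ _ _ _ y (ltW s0) (graph_subspace lG) bG.
    move=> e /ay[w gw wy]; exists w => //; by exists (w, A w).
  have [Dy zE] : D y /\ z = A y.
    by apply: cA; apply: adherent_mono az => -[a b] [/= /GD].
  rewrite -zE; split=> //; last exact: adherent_le (ltW s0) bG az.
  move=> e e0; have /adherent_pair/(_ _ e0)[[a b] [[/= ga ->] _ h]] := az.
  by exists (A a) => //; exact: growth_stable.
move=> ax k; suff [h1 h2] : adherent (growth s) (iter k A x) /\
    sqn (iter k A x) <= s ^+ k * sqn x by split=> //; case: (step _ h1).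
elim: k => [|k [IH1 IH2]]; first by rewrite expr0 mul1r.
have [_ h1 h2] := step _ IH1; split=> //=; apply: le_trans h2 _.
by rewrite exprS -mulrA ler_pM2l.
Qed.

End Growth.

(** * Vectors of bounded orbit of a symmetric operator *)
Section BoundedOrbit.
Variables (R : realType) (V : realHilbertType R) (J : V -> V) (c : R).
Hypotheses (saJ : selfadjoint J) (bJ : forall x, sqn (J x) <= c * sqn x).
Implicit Types (x y z : V).

Lemma iter_symm k x y : rdot (iter k J x) y = rdot x (iter k J y).
Proof. by elim: k x y => //= k IH x y; rewrite saJ.2 IH -iterSr. Qed.

Lemma iterT_linear k t x y :
  iter k J (t *: x + y) = t *: iter k J x + iter k J y.
Proof. by have [] := @iter_linear _ _ _ _ saJ.1 k t x y (fun _ => I) (fun _ => I). Qed.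

Lemma iterTB k x y : iter k J (x - y) = iter k J x - iter k J y.
Proof. by rewrite addrC -scaleN1r iterT_linear scaleN1r addrC. Qed.

(** The partial sums [1 + J^2 + ... + J^(2n)]. *)
Definition geom n x := \sum_(k < n.+1) iter (k + k) J x.

Lemma rdot_suml n (F : 'I_n -> V) y :
  rdot (\sum_(k < n) F k) y = \sum_(k < n) rdot (F k) y.
Proof.
elim: n F => [|n IH] F; first by rewrite !big_ord0 rdot0l.
by rewrite !big_ord_recl rdotDl IH.
Qed.

Lemma geom_symm n x y : rdot (geom n x) y = rdot x (geom n y).
Proof.
rewrite (rdotC x) !rdot_suml; apply: eq_bigr => k _.
by rewrite iter_symm rdotC.
Qed.

Lemma geom_selfadjoint n : selfadjoint (geom n).
Proof.
split; last exact: geom_symm.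
split=> // t x y _ _; rewrite /geom scaler_sumr -big_split /=.
by apply: eq_bigr => k _; rewrite iterT_linear.
Qed.

Lemma geom_iter n p x : geom n (iter p J x) = iter p J (geom n x).
Proof.
rewrite /geom (big_morph (iter p J) (id1 := 0) (op1 := +%R)).
- by apply: eq_bigr => k _; rewrite -!iterD addnC.
- by move=> y z; rewrite -[y]scale1r iterT_linear !scale1r.
- by elim: p => //= p ->; rewrite (linear_on0 saJ.1).
Qed.

Lemma geom_telescope n x :
  geom n x - iter 2 J (geom n x) = x - iter (n.+1 + n.+1) J x.
Proof.
elim: n => [|n IH]; first by rewrite /geom big_ord1.
rewrite {1 2}/geom big_ord_recr /= !(linear_onD saJ.1) //.
rewrite opprD addrACA -[X in _ - X + _]/(iter 2 J (geom n x)) IH addrA subrK.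
by rewrite -!iterS !addnS.
Qed.

Lemma rdot_geom n x : rdot (geom n x) x = \sum_(k < n.+1) sqn (iter k J x).
Proof. by rewrite rdot_suml; apply: eq_bigr => k _; rewrite iterD iter_symm. Qed.

Lemma rdot_geom_mono m n x : (n <= m)%N ->
  rdot (geom n x) x <= rdot (geom m x) x.
Proof.
rewrite !rdot_geom => /subnK <-; elim: (m - n)%N => // k IH.
by rewrite addSn [leRHS]big_ord_recr; apply: le_trans IH _; rewrite lerDl sqn_ge0.
Qed.

Lemma sqn_iter_geom k n x : (k <= n)%N -> sqn (iter k J x) <= rdot (geom n x) x.
Proof.
move=> kn; apply: le_trans (rdot_geom_mono x kn).
by rewrite rdot_geom big_ord_recr /= lerDr sumr_ge0 // => i _; exact: sqn_ge0.
Qed.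

Lemma geom_onto n x : exists y, geom n y = x.
Proof.
have lb z : setT z -> 1 * sqn z <= sqn (geom n z).
  move=> _; rewrite mul1r; have := sqn_ge0 (geom n z - z); rewrite sqnB.
  by have := sqn_iter_geom z (leq0n n); rewrite /=; lra.
have [//|//|y _ <-] := selfadjoint_onto (geom_selfadjoint n) ltr01
  (@lsubspaceT _ V) _ _ lb (I : setT x).
by exists y.
Qed.

(** On the orthogonal complement of the vectors of bounded [J]-orbit, [J] is
    bounded below by one.  With [y n] the solution of [geom n (y n) = x], the
    numbers [<y n, x>] decrease, [y n] converges to a vector [w] of bounded
    orbit, and [|x|^2 - |J x|^2 <= <y n, x>], whose limit is [<w, x> = 0]. *)
Lemma perp_bounded_orbit x :
  (forall z C, (forall k, sqn (iter k J z) <= C) -> rdot z x = 0) ->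
  sqn x <= sqn (J x).
Proof.
move=> px; have /choice[y yE] n := geom_onto n x.
pose a n := rdot (y n) x.
have aE n : a n = rdot (geom n (y n)) (y n) by rewrite yE rdotC.
have a_ge0 n : 0 <= a n.
  by rewrite aE; apply: le_trans (sqn_iter_geom (y n) (leq0n n)); exact: sqn_ge0.
have gap m n : (n <= m)%N ->
    rdot (geom n (y m - y n)) (y m - y n) <= a n - a m.
  move=> nm; have [lG sG] := geom_selfadjoint n.
  rewrite (linear_onB lG) // !rdotE (sG (y m) (y n)) (rdotC (y m) (geom n (y n))).
  rewrite -(aE n) yE (rdotC x) -/(a m).
  by have := rdot_geom_mono (y m) nm; rewrite -aE; lra.
have gap_sqn m n : (n <= m)%N -> sqn (y m - y n) <= a n - a m.
  by move=> nm; apply: le_trans (gap m n nm); exact: (@sqn_iter_geom 0).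
have a_dec m n : (n <= m)%N -> a m <= a n.
  by move=> /gap_sqn; have := sqn_ge0 (y m - y n); lra.
have [w yw] : exists w, cvgto y w.
  apply: sqn_complete => e e0.
  have ainf : has_inf (range a).
    by split; [exists (a 0%N), 0%N | exists 0 => _ [n _ <-]].
  have [_ [N _ <-] hN] := inf_adherent e0 ainf.
  exists N => m n Nm Nn.
  have low k : inf (range a) <= a k by apply: ge_inf; [case: ainf | exists k].
  have [mn|/ltnW nm] := leqP m n.
    rewrite sqnBC; have := gap_sqn _ _ mn; have := low n; have := a_dec _ _ Nm; lra.
  by have := gap_sqn _ _ nm; have := low m; have := a_dec _ _ Nn; lra.
have c0 : 0 <= `|c| by [].
have bJ' z : sqn (J z) <= `|c| * sqn z.
  by apply: le_trans (bJ z) _; rewrite ler_wpM2r ?sqn_ge0 // ler_norm.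
have bJk k z : sqn (iter k J z) <= `|c| ^+ k * sqn z.
  elim: k => [|k IH]; first by rewrite mul1r.
  rewrite iterS exprS -mulrA; apply: le_trans (bJ' _) _.
  by rewrite ler_wpM2l.
have wx : rdot w x = 0.
  apply: (px _ (2 * a 0%N + 2)) => k.
  have e0 : 0 < (`|c| ^+ k + 1)^-1 by rewrite invr_gt0 ltr_wpDl ?exprn_ge0.
  have [N hN] := yw _ e0; pose n := maxn N k.
  have := hN n (leq_maxl _ _); have := bJk k (w - y n); rewrite (sqnBC w).
  have := sqn_iter_geom (y n) (leq_maxr N k); rewrite -aE.
  have := a_dec _ _ (leq0n n).
  have := sqnD_le (iter k J (w - y n)) (iter k J (y n)).
  rewrite {1}iterTB subrK => h1 h2 h3 h4.
  rewrite -[_^-1]mul1r ltr_pdivlMr; last by rewrite ltr_wpDl ?exprn_ge0.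
  by move=> h5; have := sqn_ge0 (y n - w); lra.
have key n : sqn x - sqn (J x) <= a n.
  have tel : x - iter 2 J x = y n - iter (n.+1 + n.+1) J (y n).
    by have := geom_telescope n (y n); rewrite yE.
  have -> : sqn x - sqn (J x) = rdot (x - iter 2 J x) x.
    by rewrite !rdotE /= saJ.2.
  rewrite tel rdotDl rdotNl lerBlDr lerDl.
  have -> : rdot (iter (n.+1 + n.+1) J (y n)) x =
      rdot (geom n (iter n.+1 J (y n))) (iter n.+1 J (y n)).
    by rewrite geom_iter yE iterD iter_symm rdotC.
  rewrite rdot_geom sumr_ge0 // => i _; exact: sqn_ge0.
rewrite -subr_le0; apply/ler_addgt0Pr => e e0; rewrite add0r.
have x1 : 0 < sqn x + 1 by have := sqn_ge0 x; lra.
have [N hN] := yw _ (divr_gt0 (exprn_gt0 2 e0) x1).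
apply: le_trans (key N) _.
have -> : a N = rdot (y N - w) x by rewrite rdotDl rdotNl wx subr0.
have := hN N (leqnn _); rewrite ltr_pdivlMr // => h.
have := rdot_cauchy_schwarz (y N - w) x; have := sqn_ge0 (y N - w); nra.
Qed.

End BoundedOrbit.

(** * Normal operators *)

(** A normal operator [A] with domain [D], given together with its adjoint [A']
    of domain [D']. *)
Record normal_pair (R : realType) (V : realHilbertType R)
    (D : set V) (A : V -> V) (D' : set V) (A' : V -> V) : Prop := NormalPair {
  normal_linear : linear_on D A;
  normal_closed : closed_on D A;
  normal_adjoint : forall y z,
    (forall x, D x -> rdot (A x) y = rdot x z) <-> D' y /\ z = A' y;
  normal_dom : forall x, D x /\ D' (A x) <-> D' x /\ D (A' x);
  normal_comm : forall x, D x -> D' (A x) -> A' (A x) = A (A' x)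
}.

Section Normal.
Variables (R : realType) (V : realHilbertType R).
Variables (D : set V) (A : V -> V) (D' : set V) (A' : V -> V).
Hypothesis nA : normal_pair D A D' A'.
Implicit Types (x y z u v w : V) (e s t : R).

Let lA := normal_linear nA.
Let sD : lsubspace D := lA.1.

Lemma adjointE x y : D x -> D' y -> rdot (A x) y = rdot x (A' y).
Proof.
by move=> Dx Dy; apply: (proj2 (normal_adjoint nA y (A' y)) (conj Dy erefl)).
Qed.

Lemma adjointI y z : (forall x, D x -> rdot (A x) y = rdot x z) ->
  D' y /\ z = A' y.
Proof. exact: (proj1 (normal_adjoint nA y z)). Qed.

Lemma adjoint_linear : linear_on D' A'.
Proof.
have comb t y1 y2 : D' y1 -> D' y2 ->
    D' (t *: y1 + y2) /\ t *: A' y1 + A' y2 = A' (t *: y1 + y2).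
  by move=> h1 h2; apply: adjointI => x Dx; rewrite !rdotE !adjointE.
split; last by move=> t x y h1 h2; have [_] := comb t _ _ h1 h2.
split=> [|t x y h1 h2]; last by have [] := comb t _ _ h1 h2.
by have [] : D' 0 /\ 0 = A' 0 by apply: adjointI => x _; rewrite !rdot0r.
Qed.

(** [y = (1 + A' A)^-1 x]. *)
Definition resolvent_rel x y := [/\ D y, D' (A y) & y + A' (A y) = x].

(** Existence of the resolvent: project [(x, 0)] onto the graph of [A]. *)
Lemma resolvent_ex x : exists y, resolvent_rel x y.
Proof.
have [[y w] /(normal_closed nA)[/= Dy ->] h] :=
  projection (x, 0) (graph_subspace lA).
have [D'y yE] : D' (A y) /\ x - y = A' (A y).
  apply: adjointI => z Dz; have := h (z, A z) (conj Dz erefl).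
  rewrite rdot_pair /= sub0r rdotNl => /eqP; rewrite subr_eq0 => /eqP hz.
  by rewrite (rdotC z) hz rdotC.
by exists y; split=> //; rewrite -yE addrC subrK.
Qed.

Lemma resolvent_unique x y z :
  resolvent_rel x y -> resolvent_rel x z -> y = z.
Proof.
move=> [Dy Dy' yE] [Dz Dz' zE].
have Dw : D (y - z) by exact: lsubspaceB.
have Aw : A (y - z) = A y - A z by rewrite (linear_onB lA).
have lA' := adjoint_linear.
have Dw' : D' (A (y - z)) by rewrite Aw; apply: lsubspaceB => //; case: lA'.
have : y - z + A' (A (y - z)) = 0.
  rewrite Aw (linear_onB lA') // -(subrr x) -{1}yE -zE.
  by apply: rdot_inj => w; rewrite !rdotE; ring.
move/(congr1 (rdot (y - z))); rewrite rdotDr -adjointE // rdot0r.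
rewrite -/(sqn _) -/(sqn (A _)) => h; apply/eqP; rewrite -subr_eq0; apply/eqP.
by apply: sqn_eq0; have := sqn_ge0 (A (y - z)); lra.
Qed.

(** [D(A' A)] is a core for [A]. *)
Lemma adjoint_mul_core x : D x ->
  adherent (graph_on [set z | D z /\ D' (A z)] A) (x, A x).
Proof.
move=> Dx; set C := graph_on _ A.
have sC : lsubspace C.
  apply/graph_subspace/linear_on_subset/lA; last by move=> z [].
  have [[D'0 sD'] _] := adjoint_linear.
  split; first by split; [exact: sD.1 | rewrite (linear_on0 lA)].
  move=> t y z [Dy Dy'] [Dz Dz']; split; first exact: sD.2.
  by rewrite lA.2 //; exact: sD'.
have [[y w] Cy h] := projection (x, A x) sC.
have [/= Dy wE] : D y /\ w = A y.
  by apply: (normal_closed nA); apply: adherent_mono Cy => -[a b] [/= []].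
suff xy : x - y = 0 by move/eqP: xy; rewrite subr_eq0 => /eqP ->; rewrite -wE.
have [r [Dr Dr' rE]] := resolvent_ex (x - y).
have := h (r, A r) (conj (conj Dr Dr') erefl).
rewrite rdot_pair /= wE -(linear_onB lA) // adjointE //; last exact: lsubspaceB.
by rewrite -rdotDr rE => h0; apply: rdot_eq0.
Qed.

Lemma normal_sqn x : D x -> D' (A x) -> sqn (A' x) = sqn (A x).
Proof.
move=> Dx Dx'; have [D'x DA'x] := (normal_dom nA x).1 (conj Dx Dx').
by rewrite /sqn (adjointE Dx) // (normal_comm nA) // (rdotC x) (adjointE DA'x).
Qed.

(** Hyponormality: [D(A)] is contained in [D(A')] and [|A' x| <= |A x|] there. *)
Lemma normal_hyponormal x : D x -> D' x /\ sqn (A' x) <= sqn (A x).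
Proof.
move=> Dx.
pose M : set ((V * V) * V) :=
  [set p | exists z, [/\ D z, D' (A z) & p = ((z, A z), A' z)]].
have [[D'0 sD'] lA'] := adjoint_linear.
have sM : lsubspace M.
  split=> [|t _ _ [y [Dy Dy' ->]] [z [Dz Dz' ->]]].
    exists 0; rewrite (linear_on0 lA) (linear_on0 adjoint_linear).
    by split => //; exact: sD.1.
  have [[Dy1 _] [Dz1 _]] := ((normal_dom nA y).1 (conj Dy Dy'),
    (normal_dom nA z).1 (conj Dz Dz')).
  exists (t *: y + z); split; first exact: sD.2.
    by rewrite lA.2 //; exact: sD'.
  by rewrite lA.2 // lA'.
have bM p : M p -> sqn p.2 <= 1 * sqn p.1.
  move=> [z [Dz Dz' ->]]; rewrite /= mul1r sqn_pair /= normal_sqn //.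
  by rewrite lerDr sqn_ge0.
have [|w aw] := bounded_extension (x := (x, A x)) ler01 sM bM.
  apply: adherent_mono (adjoint_mul_core Dx) => -[a b] [[/= Da Da'] ->].
  by exists ((a, A a), A' a) => //; exists a.
have [D'x wE] : D' x /\ w = A' x.
  apply: adjointI => z Dz.
  have /eqP : rdot ((x, A x), w) ((A z, 0), - z) = 0.
    apply: adherent_perp aw _ => _ [a [Da Da' ->]].
    have [D'a _] := (normal_dom nA a).1 (conj Da Da').
    rewrite !rdot_pair /= rdot0r addr0 rdotNr (rdotC a) (rdotC (A' a)).
    by rewrite adjointE // subrr.
  rewrite !rdot_pair /= rdot0r addr0 rdotNr subr_eq0 => /eqP.
  by rewrite rdotC => ->; rewrite rdotC.
split=> //; rewrite -wE -[leRHS]mul1r.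
apply: (@adherent_le _ _ _ [set p : V * V | sqn p.2 <= 1 * sqn p.1]) => //.
apply/adherent_pair => e /((adherent_pair _ _ _).1 aw)[_ [[a [Da Da' ->]] h1 h2]].
exists (A a, A' a); split=> //=; first by rewrite mul1r normal_sqn.
by move: h1; rewrite sqn_pair /=; have := sqn_ge0 (a - x); lra.
Qed.

Lemma normal_paranormal : paranormal D A.
Proof.
move=> t x t0 Dx DAx; have [D'Ax h] := normal_hyponormal DAx.
rewrite {1}/sqn adjointE //; have := sqn_ge0 (x - t *: A' (A x)).
rewrite sqnB sqnZ rdotZr; have := sqr_ge0 t; nra.
Qed.

Lemma growth_adjoint s x : 0 < s ->
  growth D A s x -> growth D A s (A' x).
Proof.
move=> s0 gx.
have Dk k : D (iter k A x) by case: (gx k).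
have dom k : D' (iter k A x) /\ D (A' (iter k A x)).
  apply/(normal_dom nA); split=> //.
  by have [] := normal_hyponormal (Dk k.+1).
have comm k : iter k A (A' x) = A' (iter k A x).
  elim: k => //= k ->; rewrite (normal_comm nA) //.
  by have [] := normal_hyponormal (Dk k.+1).
apply: (growthP normal_paranormal (C := s * sqn x)) => // k.
rewrite comm; split; first by case: (dom k).
have [_ h] := normal_hyponormal (Dk k); apply: le_trans h _.
by have [_] := gx k.+1; rewrite /= exprS; lra.
Qed.

Lemma growth_projection s x : 0 < s ->
  exists2 y, growth D A s y & forall z, growth D A s z -> rdot (x - y) z = 0.
Proof.
move=> s0.
have [y gy h] := projection x (growth_subspace lA normal_paranormal s0).
exists y => //.
exact: (growth_closed lA (normal_closed nA) normal_paranormal s0).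
Qed.

(** ** Density of the growth spaces *)
Section Density.
Variable Q : V -> V.
Hypothesis QP : forall x, resolvent_rel x (Q x).

Lemma resolvent_eq x y : resolvent_rel x y -> Q x = y.
Proof. exact: resolvent_unique. Qed.

Lemma resolvent_linear : linear_on setT Q.
Proof.
split=> // t x y _ _; apply: resolvent_eq.
have [[Dx Dx' xE] [Dy Dy' yE]] := (QP x, QP y).
have [[_ sD'] lA'] := adjoint_linear.
split; first exact: sD.2.
  by rewrite lA.2 //; exact: sD'.
rewrite lA.2 // lA' // -[in RHS]xE -[in RHS]yE.
by apply: rdot_inj => w; rewrite !rdotE; ring.
Qed.

Lemma rdot_resolvent x y : rdot x (Q y) = rdot (Q x) (Q y) + rdot (A (Q x)) (A (Q y)).
Proof.
have [[Dx Dx' xE] [Dy Dy' yE]] := (QP x, QP y).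
by rewrite -{1}xE rdotDl (rdotC (A' _)) -adjointE // (rdotC (A (Q y))).
Qed.

Lemma resolvent_symm x y : rdot (Q x) y = rdot x (Q y).
Proof.
by rewrite rdotC (rdot_resolvent y) (rdot_resolvent x) (rdotC (Q y))
  (rdotC (A (Q y))).
Qed.

Lemma rdot_resolvent_sqn x : rdot x (Q x) = sqn (Q x) + sqn (A (Q x)).
Proof. exact: rdot_resolvent. Qed.

(** [A] commutes with the resolvent, by normality. *)
Lemma resolvent_commute x : D x -> A (Q x) = Q (A x).
Proof.
move=> Dx; have [Dy Dy' yE] := QP x; apply/esym/resolvent_eq.
have yE' : A' (A (Q x)) = x - Q x by rewrite -{2}yE addrC addKr.
have [] := (normal_dom nA (A (Q x))).2.
  by split=> //; rewrite yE'; exact: lsubspaceB.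
move=> DA D'A; split=> //.
by rewrite (normal_comm nA) // yE' (linear_onB lA) // addrC subrK.
Qed.

Lemma resolvent_sqn_le x : sqn (A (Q x)) <= sqn x /\ sqn (x - Q x) <= sqn x.
Proof.
have := rdot_resolvent_sqn x; have := sqn_ge0 (x - Q x); rewrite sqnB.
have := sqn_ge0 (A (Q x)); have := sqn_ge0 (Q x); split; lra.
Qed.

(** A scaled defect of the resolvent from the identity: for [A' A = a] it is
    multiplication by [d * a / (1 + a)]. *)
Let J d x := d *: (x - Q x).

Lemma defect_selfadjoint d : selfadjoint (J d).
Proof.
split=> [|x y]; last by rewrite /J !rdotE resolvent_symm.
split=> // t x y _ _; rewrite /J resolvent_linear.2 //.
by apply: rdot_inj => w; rewrite !rdotE; ring.
Qed.

Lemma defect_bounded d x : sqn (J d x) <= d ^+ 2 * sqn x.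
Proof.
rewrite /J sqnZ; have := sqr_ge0 d; have [_] := resolvent_sqn_le x; nra.
Qed.

Lemma defect_paranormal d : paranormal setT (J d).
Proof.
have [_ sJ] := defect_selfadjoint d.
move=> t x t0 _ _; rewrite {1}/sqn sJ; have := sqn_ge0 (x - t *: J d (J d x)).
by rewrite sqnB sqnZ rdotZr; lra.
Qed.

(** A vector whose orbit under [d (1 - Q)], [d > 1], is bounded has an orbit of
    geometric growth under [A]: the resolvent is invertible on the space of
    such vectors. *)
Lemma growth_defect_sub d : 1 < d ->
  exists2 s, 0 < s & growth setT (J d) 1 `<=` growth D A s.
Proof.
move=> d1; have d0 : 0 < d by lra.
set L := growth setT (J d) 1.
have [lJ sJ] := defect_selfadjoint d.
have cJ := selfadjoint_closed (defect_selfadjoint d).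
have pJ := @defect_paranormal d.
have sL : lsubspace L := growth_subspace lJ pJ ltr01.
have LQ x : L x -> L (Q x).
  move=> Lx; have -> : Q x = x - d^-1 *: J d x.
    by rewrite scalerA mulVf ?lt0r_neq0 // scale1r opprB addrC subrK.
  exact: (lsubspaceB sL Lx (lsubspaceZ _ sL (growth_stable pJ ltr01 Lx))).
pose c : R := (1 - d^-1 ^+ 2) / 2.
have c0 : 0 < c.
  by rewrite divr_gt0 // subr_gt0 exprn_ilt1 ?invr_ge0 ?invf_lt1 // ltW.
have lbQ x : L x -> c ^+ 2 * sqn x <= sqn (Q x).
  move=> /growth_sqn; rewrite mul1r sqnZ mulrC -ler_pdivlMr ?exprn_gt0 //.
  rewrite -exprVn sqnB => h; have := rdot_young x (Q x) c0 => hy.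
  have : c * (c * sqn x) <= c * (sqn (Q x) / c).
    by rewrite ler_pM2l //; have := sqn_ge0 (Q x); move: h hy; rewrite /c; lra.
  rewrite [leRHS]mulrC divfK ?lt0r_neq0 //; lra.
have saQ : selfadjoint Q by split; [exact: resolvent_linear | exact: resolvent_symm].
have onto := selfadjoint_onto saQ (exprn_gt0 2 c0) sL
  (fun x => @growth_closed _ _ _ _ lJ cJ pJ 1 x ltr01) LQ lbQ.
have AQ t x y : A (Q (t *: x + y)) = t *: A (Q x) + A (Q y).
  by rewrite resolvent_linear.2 // lA.2 //; [case: (QP x) | case: (QP y)].
have JAQ x : J d (A (Q x)) = A (Q (J d x)).
  have -> : J d x = d *: x + (- d) *: Q x.
    by apply: rdot_inj => w; rewrite /J !rdotE; ring.
  rewrite AQ -[_ *: Q x]addr0 AQ (linear_on0 resolvent_linear) (linear_on0 lA).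
  rewrite addr0 /J scalerBr scaleNr; congr (_ - _ *: _).
  by rewrite -resolvent_commute //; case: (QP x).
have iJAQ k x : iter k (J d) (A (Q x)) = A (Q (iter k (J d) x)).
  by elim: k => //= k ->; rewrite JAQ.
have key x : L x -> [/\ D x, L (A x) & sqn (A x) <= (c ^+ 2)^-1 * sqn x].
  move=> /[dup] Lx /onto[y Ly yx]; have Dx : D x by rewrite -yx; case: (QP y).
  have hy : sqn (A x) <= sqn y by rewrite -yx; case: (resolvent_sqn_le y).
  split=> //; last first.
    by apply: le_trans hy _; rewrite ler_pdivlMl ?exprn_gt0 // -yx; exact: lbQ.
  apply: (growthP pJ (C := sqn y)) => // k; split=> //.
  rewrite -yx iJAQ; have [h _] := resolvent_sqn_le (iter k (J d) y).
  by apply: le_trans h _; have [_] := Ly k; rewrite mulrC.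
have s0 : 0 < (c ^+ 2)^-1 by rewrite invr_gt0 exprn_gt0.
exists (c ^+ 2)^-1 => // x Lx k.
suff [Lk hk] : L (iter k A x) /\ sqn (iter k A x) <= (c ^+ 2)^-1 ^+ k * sqn x.
  by split=> //; case: (key _ Lk).
elim: k => [|k [Lk hk]]; first by rewrite mul1r.
have [_ h1 h2] := key _ Lk; split=> //=; apply: le_trans h2 _.
by rewrite (exprS _ k) -mulrA ler_pM2l.
Qed.

Lemma perp_growth_eq0 x :
  (forall s y, 0 < s -> growth D A s y -> rdot y x = 0) -> x = 0.
Proof.
move=> px.
have hd d : 1 < d -> sqn x <= d ^+ 2 * sqn (x - Q x).
  move=> d1; rewrite -sqnZ; have [s s0 sub] := growth_defect_sub d1.
  apply: (perp_bounded_orbit (defect_selfadjoint d) (@defect_bounded d)).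
  move=> z C zC; apply: (px s) => //; apply: sub.
  by apply: (growthP (@defect_paranormal d) (C := C)) => // k; rewrite expr1n mulr1.
(* let [d = 1 + t] tend to one, with [t] such that [(d^2 - 1) q <= 3 t q <= e] *)
have h : sqn x <= sqn (x - Q x).
  apply/ler_addgt0Pr => e e0; set q := sqn (x - Q x) in hd *.
  have q0 : 0 <= q := sqn_ge0 _.
  pose t := Num.min 1 (e / (3 * (q + 1))).
  have q3 : 0 < 3 * (q + 1) by lra.
  have t0 : 0 < t by rewrite lt_min ltr01 divr_gt0.
  have t1 : t <= 1 by rewrite ge_min lexx.
  have te : t * (3 * (q + 1)) <= e.
    by rewrite -ler_pdivlMr // ge_min lexx orbT.
  have /hd : 1 < 1 + t by lra.
  have : (1 + t) ^+ 2 <= 1 + 3 * t by nra.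
  nra.
have Q0 : Q x = 0.
  apply: sqn_eq0; move: h; rewrite sqnB rdot_resolvent_sqn.
  by have := sqn_ge0 (A (Q x)); have := sqn_ge0 (Q x); lra.
have [_ _ <-] := QP x.
by rewrite Q0 (linear_on0 lA) (linear_on0 adjoint_linear) addr0.
Qed.

End Density.

(** The vectors of geometric growth are dense. *)
Lemma growth_dense x e : 0 < e ->
  exists s y, [/\ 0 < s, growth D A s y & sqn (y - x) < e].
Proof.
move=> e0; have /choice[Q QP] := resolvent_ex.
pose M := [set y | exists2 s, 0 < s & growth D A s y].
have sM : lsubspace M.
  split=> [|t y z [s s0 gy] [s' s0' gz]].
    exists 1 => //; exact: (growth_subspace lA normal_paranormal ltr01).1.
  have m0 : 0 < Num.max s s' by rewrite lt_max s0.
  exists (Num.max s s') => //.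
  apply: (growth_subspace lA normal_paranormal m0).2.
    by apply: growth_mono gy; rewrite ?le_max ?lexx // ltW.
  by apply: growth_mono gz; rewrite ?le_max ?lexx ?orbT // ltW.
have [y My h] := projection x sM.
have /eqP : x - y = 0.
  apply: (perp_growth_eq0 QP) => s z s0 gz; rewrite rdotC; apply: h.
  by exists s.
rewrite subr_eq0 => /eqP ->; have [z [s s0 gz] zy] := My _ e0.
by exists s, z.
Qed.

(** If [B] is bounded and self-adjoint, [A] is normal and [B A'] is contained in
    [A B], then [A B] is contained in the closure of [B A']. *)
Lemma mul_sub_closure (B : V -> V) b : selfadjoint B ->
  (forall x, sqn (B x) <= b * sqn x) ->
  (forall x, D' x -> D (B x) /\ A (B x) = B (A' x)) ->
  forall x, D (B x) ->
    adherent [set p : V * V | D' p.1 /\ p.2 = B (A' p.1)] (x, A (B x)).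
Proof.
move=> saB bB BA x DBx; have [lB sB] := saB.
apply/adherent_pair => e e0.
have [s1 [y1 [s10 gy1 xy1]]] := growth_dense x e0.
have [s2 [y2 [s20 gy2 xy2]]] := growth_dense (A (B x)) e0.
pose s := Num.max s1 s2; set G := growth D A s.
have s0 : 0 < s by rewrite lt_max s10.
have {gy1} gy1 : G y1 by apply: growth_mono gy1; rewrite ?le_max ?lexx // ltW.
have {gy2} gy2 : G y2.
  by apply: growth_mono gy2; rewrite ?le_max ?lexx ?orbT // ltW.
have sG : lsubspace G := growth_subspace lA normal_paranormal s0.
have GD' y : G y -> D' y by move=> /growth_dom /normal_hyponormal[].
(* the projection minimizes the distance to [G] *)
have best z y : G z -> (forall g, G g -> rdot (y - z) g = 0) ->
    forall g, G g -> sqn (z - y) <= sqn (g - y).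
  move=> Gz h g Gg; have -> : g - y = (z - y) - (z - g).
    by apply: rdot_inj => w; rewrite !rdotE; ring.
  rewrite (sqnB (z - y)) -(opprB y z) rdotNl h; last exact: lsubspaceB sG Gz Gg.
  by have := sqn_ge0 (z - g); lra.
(* [B] preserves [G], since the orbit of [B y] under [A] is the image by [B] of
   the orbit of [y] under [A'] *)
have GB y : G y -> G (B y).
  move=> Gy.
  have GA' k : G (iter k A' y) /\ sqn (iter k A' y) <= s ^+ k * sqn y.
    elim: k => [|k [Gk hk]]; first by rewrite mul1r.
    split; first exact: growth_adjoint.
    have [_ h] := normal_hyponormal (growth_dom Gk); rewrite /=.
    apply: le_trans h _; apply: le_trans (growth_sqn Gk) _.
    by rewrite exprS -mulrA ler_pM2l.
  have orb k : iter k A (B y) = B (iter k A' y).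
    by elim: k => //= k ->; have [_ ->] := BA _ (GD' _ (GA' k).1).
  apply: (growthP normal_paranormal (C := `|b| * sqn y)) => // k.
  rewrite orb; split; first by have [] := BA _ (GD' _ (GA' k).1).
  apply: le_trans (bB _) _; have [_ h] := GA' k.
  have := sqn_ge0 (iter k A' y); have := ler_norm b; have := normr_ge0 b.
  nra.
have [z Gz zx] := growth_projection x s0.
have Dz := growth_dom Gz; have DBz := growth_dom (GB _ Gz).
exists (z, B (A' z)); split=> /=; first by split=> //; exact: GD'.
  by apply: le_lt_trans xy1; exact: best.
have [_ <-] := BA _ (GD' _ Gz).
apply: le_lt_trans xy2; apply: best => // [|g Gg].
  by apply: growth_stable => //; [exact: normal_paranormal | exact: GB].
have Dg := GD' _ Gg.
rewrite -(linear_onB lA) // adjointE //; last exact: lsubspaceB.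
rewrite -(linear_onB lB) // sB; apply: zx; apply: GB.
exact: growth_adjoint.
Qed.

End Normal.

(** The double adjoint is contained in the closure: [(u, v)] lies in the closure
    of the graph of [T] if [<w', u> = <w, v>] for all [(w, w')] in the graph of
    the adjoint. *)
Lemma double_adjoint_closure (R : realType) (V : realHilbertType R)
    (D : set V) (T : V -> V) (u v : V) : linear_on D T ->
  (forall w w', (forall x, D x -> rdot (T x) w = rdot x w') ->
     rdot w' u = rdot w v) ->
  adherent (graph_on D T) (u, v).
Proof.
move=> lT h; have [[y z] ayz hp] := projection (u, v) (graph_subspace lT).
have adj x : D x -> rdot (T x) (v - z) = rdot x (y - u).
  move=> Dx; have := hp (x, T x) (conj Dx erefl); rewrite rdot_pair /= => hx.
  by rewrite rdotC (rdotC x) -(opprB u y) rdotNl; lra.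
have adj' : rdot z (v - z) = rdot y (y - u).
  have /eqP : rdot (y, z) (u - y, v - z) = 0.
    apply: adherent_perp ayz _ => -[a b] [/= Da ->]; rewrite rdot_pair /= adj //.
    by rewrite !rdotE; ring.
  by rewrite rdot_pair /= !rdotE => /eqP; lra.
have huv := h _ _ adj.
have uv0 : sqn (u - y) + sqn (v - z) = 0.
  rewrite !sqnB (rdotC u y) (rdotC v z) /sqn; move: huv adj'.
  by rewrite !rdotE; lra.
have /eqP : u - y = 0.
  by apply: sqn_eq0; have := sqn_ge0 (v - z); lra.
rewrite subr_eq0 => /eqP ->.
have /eqP : v - z = 0.
  by apply: sqn_eq0; have := sqn_ge0 (u - y); lra.
by rewrite subr_eq0 => /eqP ->.
Qed.

(** * Complex Hilbert spaces as real ones *)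

Local Open Scope complex_scope.

Section ComplexInner.
Variables (R : realType) (H : hilbertType R).
Implicit Types x y z : H.

(** The real part of the inner product. *)
Definition rehdot x y : R := complex.Re (hdot x y).

Lemma ReD (a b : R[i]) : complex.Re (a + b) = complex.Re a + complex.Re b.
Proof. by case: a b => [? ?] []. Qed.

Lemma ReJ (a : R[i]) : complex.Re (Num.conj a) = complex.Re a.
Proof. by rewrite (_ : Num.conj a = conjc a) //; case: a. Qed.

Lemma rehdotC x y : rehdot x y = rehdot y x.
Proof. by rewrite /rehdot hermC expr0 mul1r; exact: ReJ. Qed.

Lemma rehdotDl x y z : rehdot (x + y) z = rehdot x z + rehdot y z.
Proof. by rewrite /rehdot linearDl ReD. Qed.

Lemma rehdotZl (a : R) x y : rehdot (a%:C *: x) y = a * rehdot x y.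
Proof.
rewrite /rehdot linearZl_LR /=; case: (hdot x y) => b c /=.
by rewrite mul0r subr0.
Qed.

Lemma rehdot_norm x : (rehdot x x)%:C = `|x| ^+ 2.
Proof. by rewrite /rehdot -hdot_norm RRe_real // realX. Qed.

Lemma rehdot_ge0 x : 0 <= rehdot x x.
Proof. by rewrite -ler0c rehdot_norm exprn_ge0. Qed.

Lemma rehdot_eq0 x : rehdot x x = 0 -> x = 0.
Proof.
move=> h; apply/eqP; rewrite -normr_eq0 -sqrf_eq0.
by rewrite -rehdot_norm h.
Qed.

Lemma gt0_Re (e : R[i]) : 0 < e -> exists2 d : R, 0 < d & e = d%:C.
Proof.
by case: e => a b; rewrite ltcE /= => /andP[/eqP -> a0]; exists a.
Qed.

Lemma normr_ltE x (d : R) : 0 < d -> (`|x| < d%:C) = (rehdot x x < d ^+ 2).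
Proof.
move=> d0; have d0' : 0 <= d%:C :> R[i] by rewrite ler0c ltW.
by rewrite -(@ltr_pXn2r _ 2) ?nnegrE // -rehdot_norm -rmorphXn ltcR.
Qed.

Lemma ball_ltE x y (d : R) : 0 < d ->
  ball x d%:C y <-> rehdot (y - x) (y - x) < d ^+ 2.
Proof. by move=> d0; rewrite -normr_ltE // -ball_normE /= distrC. Qed.

Lemma rehdot_complete (u : nat -> H) :
  (forall e, 0 < e -> exists N, forall m n, (N <= m)%N -> (N <= n)%N ->
     rehdot (u m - u n) (u m - u n) < e) ->
  exists y, forall e, 0 < e -> exists N, forall n, (N <= n)%N ->
     rehdot (u n - y) (u n - y) < e.
Proof.
move=> cu; have /cauchy_cvg ul : cauchy (u @ \oo).
  apply/cauchyP => _ /gt0_Re[d d0 ->].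
  have [N hN] := cu _ (exprn_gt0 2 d0); exists (u N); exists N => // n /= Nn.
  by apply/ball_ltE => //; exact: hN.
exists (lim (u @ \oo)) => e e0.
have se0 : 0 < Num.sqrt e by rewrite sqrtr_gt0.
have d0 : 0 < (Num.sqrt e)%:C :> R[i] by rewrite ltcR.
have [N _ hN] := ul _ (nbhsx_ballx (lim (u @ \oo)) _ d0).
exists N => n Nn; rewrite -(sqr_sqrtr (ltW e0)); apply/ball_ltE => //.
exact: hN.
Qed.

End ComplexInner.

(** Restriction of scalars: the real Hilbert space underlying a complex one. *)
Definition realified (R : realType) (H : hilbertType R) : Type := H.

Section Realified.
Variables (R : realType) (H : hilbertType R).

HB.instance Definition _ := GRing.Zmodule.copy (realified H) H.

Definition real_scale (a : R) (x : realified H) : realified H :=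
  a%:C *: (x : H).

Lemma real_scaleA a b v : real_scale a (real_scale b v) = real_scale (a * b) v.
Proof. by rewrite /real_scale scalerA rmorphM. Qed.

Lemma real_scale1 : left_id 1 real_scale.
Proof. by move=> v; rewrite /real_scale rmorph1 scale1r. Qed.

Lemma real_scaleDr : right_distributive real_scale +%R.
Proof. by move=> a u v; rewrite /real_scale scalerDr. Qed.

Lemma real_scaleDl v : {morph real_scale^~ v : a b / a + b}.
Proof. by move=> a b; rewrite /real_scale rmorphD scalerDl. Qed.

HB.instance Definition _ := GRing.Zmodule_isLmodule.Build R (realified H)
  real_scaleA real_scale1 real_scaleDr real_scaleDl.

HB.instance Definition _ := isRealHilbert.Build R (realified H)
  (@rehdotC R H) (@rehdotDl R H) (@rehdotZl R H) (@rehdot_ge0 R H)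
  (@rehdot_eq0 R H) (@rehdot_complete R H).

Lemma realifiedE (x y : realified H) : rdot x y = complex.Re (hdot (x : H) y).
Proof. by []. Qed.

Lemma sqn_ltE (x y : realified H) (d : R) : 0 < d ->
  ball (x : H) d%:C y <-> sqn (y - x) < d ^+ 2.
Proof. exact: ball_ltE. Qed.

Lemma sqrt_gt0C (e : R) : 0 < e -> 0 < (Num.sqrt e)%:C :> R[i].
Proof. by move=> e0; rewrite ltcR sqrtr_gt0. Qed.

Lemma closure_pair_adherent (M : set (H * H)) (x y : H) :
  closure M (x, y) <->
  @adherent R (realified H * realified H)%type M (x, y).
Proof.
split=> [h|/adherent_pair h].
  apply/adherent_pair => e e0; have se := sqrt_gt0C e0.
  have [p [Mp [p1 p2]]] := h _ (nbhsx_ballx ((x, y) : H * H) _ se).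
  have s0 : 0 < Num.sqrt e by rewrite sqrtr_gt0.
  by exists p; split=> //; rewrite -(sqr_sqrtr (ltW e0)); apply/sqn_ltE.
move=> B /nbhs_ballP[_ /= /gt0_Re[d d0 ->] dB].
have [p [Mp p1 p2]] := h _ (exprn_gt0 2 d0); exists p; split=> //.
by apply: dB; split; apply/sqn_ltE.
Qed.

Lemma dense_adherent (M : set H) : dense M ->
  forall x, @adherent R (realified H) M x.
Proof.
move=> dM x e e0; have se := sqrt_gt0C e0.
have s0 : 0 < Num.sqrt e by rewrite sqrtr_gt0.
have nb := nbhsx_ballx (x : H) _ se.
have [y [By My]] := dM _ (ex_intro _ _ (nbhs_singleton nb)) (ball_open (x : H) _).
by exists y => //; rewrite -(sqr_sqrtr (ltW e0)); apply/sqn_ltE.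
Qed.

Lemma is_operator_linear (T : pfun H) : is_operator T ->
  @linear_on R (realified H) (dom T) T.
Proof.
by move=> [T0 Ts Tl]; split; [split=> // t x y; exact: Ts | move=> t x y; exact: Tl].
Qed.

(** As [T] is linear over the complex numbers, real parts suffice to test the
    adjoint relation. *)
Lemma adjoint_relE (T : pfun H) (y z : H) : is_operator T ->
  adjoint_rel T y z <->
  forall x : realified H, dom T x -> rdot (T x : realified H) y = rdot x z.
Proof.
move=> [T0 Ts Tl]; split=> [h x Tx|h x Tx]; first by rewrite !realifiedE h.
have hi := h _ (Ts 'i x 0 Tx T0); rewrite Tl // in hi.
have T00 : T 0 = 0.
  have := Tl 1 0 0 T0 T0; rewrite !scale1r addr0 => /eqP.
  by rewrite -subr_eq subrr => /eqP.
move: hi (h _ Tx); rewrite T00 !addr0 !realifiedE !linearZl_LR /=.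
case: (hdot (T x) y) (hdot x z) => [a b] [c d] /=; rewrite !mul0r !sub0r !mul1r.
by move=> /oppr_inj -> ->.
Qed.

Lemma adjoint_rel_unique (T : pfun H) (y z z' : H) : densely_defined T ->
  adjoint_rel T y z -> adjoint_rel T y z' -> z = z'.
Proof.
move=> dT hz hz'; apply/eqP; rewrite -subr_eq0; apply/eqP.
apply: (@rdot_eq0 R (realified H)).
apply: adherent_perp (dense_adherent dT (z - z')) _ => x Tx.
have : hdot (x : H) (z - z') = 0.
  have -> : hdot (x : H) (z - z') = hdot (x : H) z - hdot (x : H) z'.
    exact: linearBr.
  by rewrite -(hz _ Tx) -(hz' _ Tx) subrr.
exact: (congr1 (@complex.Re R)).
Qed.

Lemma adjointP (T : pfun H) (y z : H) : densely_defined T ->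
  adjoint_rel T y z <-> dom (adjoint T) y /\ z = adjoint T y.
Proof.
move=> dT; split=> [h|[[z' hz'] ->]]; last exact: (getPex (ex_intro _ _ hz')).
have ex : exists z, adjoint_rel T y z by exists z.
by split=> //; apply: adjoint_rel_unique dT h _; exact: (getPex ex).
Qed.

Lemma op_closed_on (T : pfun H) :
  op_closed T <-> @closed_on R (realified H) (dom T) T.
Proof.
split=> [cT x y /closure_pair_adherent axy|cT [x y] /closure_pair_adherent axy].
  exact: (cT (x, y)).
exact: cT.
Qed.

Lemma op_normal_pair (A : pfun H) : is_operator A -> op_normal A ->
  @normal_pair R (realified H) (dom A) A (dom (adjoint A)) (adjoint A).
Proof.
move=> opA [dA cA [[s1 v1] [s2 v2]]]; split.
- exact: is_operator_linear.
- exact/op_closed_on.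
- by move=> y z; rewrite -(adjointP _ _ dA) (adjoint_relE _ _ opA).
- by move=> x; split=> [[Ax AAx]|[Ax AAx]]; [exact: s2 | exact: s1].
- by move=> x Ax AAx; exact: v2.
Qed.

End Realified.

Theorem theorem3p8 (R : realType) (H : hilbertType R) (A B T : pfun H)
    (opA : is_operator A) (opB : is_operator B) (opT : is_operator T)
    (bndB : everywhere_bounded B)
    (denseT : densely_defined T)
    (symT : op_symmetric (adjoint T))
    (saB : op_selfadjoint B)
    (normA : op_normal A)
    (subT : op_sub T (op_mul A B)) :
  op_eq (op_closure T) (op_mul A B) /\
  (op_closed T -> op_eq T (op_mul A B)).
Proof.
pose V : realHilbertType R := realified H.
have nA := op_normal_pair opA normA.
have lT : @linear_on R V (dom T) T by exact: is_operator_linear.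
have [BT [M0 bM]] := bndB.
have sB (x y : H) : hdot (B x) y = hdot x (B y).
  have [dB [sub _]] := saB; have By : dom B y by rewrite BT.
  have /(adjointP _ _ dB) h : dom (adjoint B) y /\ B y = adjoint B y.
    by split; [exact: sub.1 | exact: sub.2].
  by rewrite h // BT.
have rB : @selfadjoint R V B.
  split=> [|x y]; last by rewrite !realifiedE sB.
  by have := is_operator_linear opB; rewrite BT.
pose b : R := complex.Re (`|M0| ^+ 2)%R.
have bB (x : V) : @sqn R V (B x) <= b * @sqn R V x.
  have bE : b%:C%C = `|M0| ^+ 2 by rewrite /b RRe_real // realX.
  rewrite -lecR rmorphM /= bE.
  rewrite [X in X <= _](rehdot_norm (B x)) [X in _ * X](rehdot_norm (x : H)).
  have Mx : 0 <= M0 * `|x : H| := le_trans (normr_ge0 _) (bM x).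
  rewrite -exprMn ler_pXn2r ?nnegrE ?mulr_ge0 //.
  by apply: le_trans (bM x) _; rewrite -(ger0_norm Mx) normrM normr_id.
(* [A B] is closed *)
have cAB (x y : V) :
    adherent [set p : V * V | dom A (B p.1) /\ p.2 = A (B p.1)] (x, y) ->
    dom A (B x) /\ y = A (B x).
  move=> /adherent_pair h; apply: (normal_closed nA).
  apply/adherent_pair => e e0.
  have b1 : 0 < `|b| + 1 by rewrite ltr_wpDl.
  have eb : e / (`|b| + 1) <= e.
    by rewrite ler_pdivrMr // ler_peMr ?lerDr // ltW.
  have [[p1 p2] [[/= Ap ->] h1 h2]] := h _ (divr_gt0 e0 b1).
  exists (B p1 : V, A (B p1) : V); split=> //=; last exact: lt_le_trans h2 eb.
  rewrite -(linear_onB rB.1) //; apply: le_lt_trans (bB _) _.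
  move: h1; rewrite ltr_pdivlMr //; have := sqn_ge0 (p1 - x).
  by have := ler_norm b; nra.
(* [B A^* <= T^* <= T^** <= closure of T], as graphs *)
have clT (x : V) : dom (adjoint A) x ->
    @adherent R (V * V)%type (@graph_on R V (dom T) T) (x, B (adjoint A x)).
  move=> Ax; have [dA _ _] := normA.
  have relA := (adjointP x (adjoint A x) dA).2 (conj Ax erefl).
  have relT : adjoint_rel T x (B (adjoint A x)).
    move=> t Tt; rewrite subT.2 //=; have [Bt ABt] := subT.1 _ Tt.
    by rewrite relA // sB.
  have [Tx TxE] := (adjointP _ _ denseT).1 relT.
  have [dT' [s1 s2]] := symT.
  have relT' := (adjointP x (adjoint T x) dT').2 (conj (s1 _ Tx) (s2 _ Tx)).
  apply: double_adjoint_closure lT _ => w w' /(adjoint_relE w w' opT).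
  move=> /(adjointP _ _ denseT)[Tw ->].
  by rewrite !realifiedE relT' // TxE.
have clAB (x y : V) :
    @adherent R (V * V)%type (@graph_on R V (dom T) T) (x, y) ->
    dom A (B x) /\ y = A (B x).
  move=> axy; apply: cAB; apply: adherent_mono axy => -[p1 p2] [/= Tp ->].
  by have [_ ?] := subT.1 _ Tp; split=> //; rewrite subT.2.
have BA (x : V) : dom (adjoint A) x ->
    dom A (B x) /\ A (B x) = B (adjoint A x).
  by move=> /clT /clAB[].
have ABcl (x : V) : dom A (B x) ->
    @adherent R (V * V)%type (@graph_on R V (dom T) T) (x, A (B x)).
  move=> ABx; apply: adherent_adherent.
  apply: adherent_mono (mul_sub_closure nA rB bB BA ABx) => -[p1 p2] [/= Ap ->].
  exact: clT.
have graphE (x y : H) :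
    closure (op_graph T) (x, y) <-> dom A (B x) /\ y = A (B x).
  split=> [/closure_pair_adherent/clAB //|[ABx ->]].
  by apply/closure_pair_adherent; exact: ABcl.
have domE (x : H) : dom (op_mul A B) x <-> dom A (B x).
  by split=> [[]|ABx] //; split=> //; rewrite BT.
split.
  have val (x : H) : dom A (B x) -> op_closure T x = A (B x).
    move=> ABx.
    have ex : exists y, closure (op_graph T) (x, y).
      by exists (A (B x)); apply/graphE.
    by have /graphE[] := getPex ex.
  split; split=> x.
  - by move=> [y /graphE[ABx _]]; apply/domE.
  - by move=> [y /graphE[ABx _]]; exact: val.
  - by move=> /domE ABx; exists (A (B x)); apply/graphE.
  - by move=> /domE ABx; rewrite val.
move=> cT; split=> //; split=> x /domE ABx.
  by have [] := cT (x, A (B x)) ((graphE _ _).2 (conj ABx erefl)).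
by have [] := cT (x, A (B x)) ((graphE _ _).2 (conj ABx erefl)).
Qed.
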